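(* Let $q\in\{0,1\}$ and let $\vec X(s)=(r(s),z(s))^\top$, $s\in[0,L]$, be a smooth plane curve parametrized by arc length, with $r>0$, tangent $\vec\tau=\partial_s\vec X=(\cos\theta,\sin\theta)^\top$ (with $\theta=\theta(s)$ smooth), normal $\vec n=-(\partial_s\vec X)^\perp$ and curvature $\kappa=-(\partial_{ss}\vec X)\cdot\vec n$. Then for a scalar function $\mu=\mu(s)$ the equation $$\mu=-\left[\gamma(\theta)+\gamma''(\theta)\right]\kappa+\frac{\gamma(\theta)\,\partial_s z+\gamma'(\theta)\,\partial_s r}{r}$$ can be equivalently written as $$r\mu\,\vec n=\partial_s\left[r\,\boldsymbol{B}_q(\theta)\,\partial_s\vec X\right]-\gamma(\theta)\,\vec e_1,\qquad \vec e_1=(1,0)^\top .$$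
   Context: Notation: $(a,b)^\perp=(b,-a)$ is clockwise rotation by $\pi/2$, so $\vec n=-\vec\tau^\perp=(-\sin\theta,\cos\theta)^\top$. $\gamma=\gamma(\theta)>0$ is the surface energy density, a $C^2$, even, $2\pi$-periodic function of the angle $\theta$. $\mathscr S(\theta)$ is a given real-valued ($2\pi$-periodic) function, called the stability function. For $q\in\{0,1\}$ the surface energy matrix is $$\boldsymbol{B}_q(\theta)=\begin{pmatrix}\gamma(\theta)&-\gamma'(\theta)\\ \gamma'(\theta)&\gamma(\theta)\end{pmatrix}\begin{pmatrix}\cos2\theta&\sin2\theta\\ \sin2\theta&-\cos2\theta\end{pmatrix}^{1-q}+\mathscr S(\theta)\left[\frac12\boldsymbol I-\frac12\begin{pmatrix}\cos2\theta&\sin2\theta\\ \sin2\theta&-\cos2\theta\end{pmatrix}\right],$$ where $\boldsymbol I$ is the $2\times2$ identity matrix (and the zeroth power of a matrix is $\boldsymbol I$). *)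

(* Defs.v *)
From HB Require Import structures.
From mathcomp Require Import all_boot all_order all_algebra.
From mathcomp Require Import all_classical all_reals all_analysis.
Import Order.TTheory GRing.Theory Num.Theory.
Import numFieldNormedType.Exports.

Set Implicit Arguments.
Unset Strict Implicit.
Unset Printing Implicit Defensive.

Local Open Scope ring_scope.
Local Open Scope classical_set_scope.

Section WithinDerivative.
Variables (R : realType) (V : normedModType R).
Implicit Types (A : set R) (f : R -> V).

Definition diffquot f (s t : R) : V := (t - s)^-1 *: (f t - f s).

(* Derivatives relative to A: only increments staying in A are used, so that
   for A = `[0, L] they are two-sided at interior points and one-sided at the
   endpoints, and values of f outside A play no role. *)
Definition wderivable A f (s : R) : Prop :=
  cvg (diffquot f s t @[t --> within A s^']).

Definition wderive A f (s : R) : V :=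
  lim (diffquot f s t @[t --> within A s^']).

(* C^oo on A, including the endpoints when A is a closed interval. *)
Definition wsmooth A f : Prop :=
  forall n s, A s -> wderivable A (iter n (wderive A) f) s.

End WithinDerivative.

Definition C2 (R : realType) (f : R -> R) : Prop :=
  [/\ forall x, derivable f x 1,
      forall x, derivable (derive1 f) x 1 &
      continuous (derive1n 2 f)].

Section Plane.
Variable R : realType.
Implicit Types (a b c d : R) (u v : 'cV[R]_2).

Definition vec2 a b : 'cV[R]_2 := \col_i (if i == 0 then a else b).

Definition mat2 a b c d : 'M[R]_2 :=
  \matrix_(i, j) (if i == 0 then (if j == 0 then a else b)
                  else (if j == 0 then c else d)).

Definition dot u v : R := (u^T *m v) 0 0.

Definition perp v : 'cV[R]_2 := vec2 (v 1 0) (- v 0 0).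

Definition e1 : 'cV[R]_2 := vec2 1 0.

(* [stab] is the stability function. *)
Definition surface_energy_matrix (gamma stab : R -> R) (q : nat) (theta : R) :
    'M[R]_2 :=
  let H := mat2 (cos (2 * theta)) (sin (2 * theta))
                (sin (2 * theta)) (- cos (2 * theta)) in
  mat2 (gamma theta) (- derive1 gamma theta) (derive1 gamma theta) (gamma theta)
    * H ^+ (1 - q)
  + stab theta *: (2^-1 *: 1%:M - 2^-1 *: H).

End Plane.

Section Curve.
Variables (R : realType) (L : R) (X : R -> 'cV[R]_2).

Definition tangent : R -> 'cV[R]_2 := wderive `[0, L] X.

Definition normal (s : R) : 'cV[R]_2 := - perp (tangent s).

Definition curvature (s : R) : R :=
  - dot (wderive `[0, L] tangent s) (normal s).

Definition rcoord (s : R) : R := X s 0 0.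

Definition zcoord (s : R) : R := X s 1 0.

End Curve.

(* Main.v *)
Require Import Defs.
From HB Require Import structures.
From mathcomp Require Import all_boot all_order all_algebra.
From mathcomp Require Import all_classical all_reals all_analysis.
From mathcomp Require Import ring.
Import Order.TTheory GRing.Theory Num.Theory.
Import numFieldNormedType.Exports.

Local Open Scope ring_scope.
Local Open Scope classical_set_scope.

(** Write [tau = (cos theta, sin theta)] and [n = (- sin theta, cos theta)].
    The matrix [H] of the reflection of axis [tau] fixes [tau]
    ([reflection_tangent]), so in [B_q tau] the power of [H] disappears,
    whatever [q] is, and so does the stability term, which is a multiple of
    [(I - H) tau].  What is left is [gamma tau + gamma' n], the Cahn-Hoffman
    vector [gamma n - gamma' tau] turned clockwise by a right angle
    ([surface_energy_tangent]).

    Since [tau' = theta' n], [n' = - theta' tau] and [r' = cos theta], the two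
    [theta' gamma' tau] terms cancel in the derivative of
    [r (gamma tau + gamma' n)], leaving
    [cos theta (gamma tau + gamma' n) + r theta' (gamma + gamma'') n].
    As [e1 = cos theta tau - sin theta n], subtracting [gamma e1] removes the
    tangential part and gives [K n] with
    [K = r theta' (gamma + gamma'') + gamma sin theta + gamma' cos theta].
    The vector equation is therefore [r mu n = K n], that is [r mu = K] because
    [n] is a unit vector; dividing by [r > 0] and using [kappa = - theta'],
    [z' = sin theta], [r' = cos theta], this is the scalar equation.

    The derivatives are relative to a set of parameters, so the sum, product and
    chain rules are proved for limits of difference quotients along
    [within A s^'].  That filter has to be proper for derivatives to be unique,
    which holds at every point of a segment of positive length
    ([within_itv_proper]).  Only the values on [A] matter
    ([eq_has_wderive]): this is what allows the flux, and the tangent, to be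
    replaced by their expressions in [theta] before differentiating. *)

(** * Derivatives relative to a set *)

Section RelativeDerivative.
Context {R : realType} {V : normedModType R}.
Implicit Types (A : set R) (f g : R -> V) (s : R).

Definition has_wderive A f s (d : V) : Prop :=
  diffquot f s t @[t --> within A s^'] --> d.

Lemma has_wderive_wderivable {A f s d} :
  has_wderive A f s d -> wderivable A f s.
Proof. by move=> fd; apply/cvg_ex; exists d. Qed.

Lemma has_wderive_val {A f s d} : ProperFilter (within A s^') ->
  has_wderive A f s d -> wderive A f s = d.
Proof. by move=> pA fd; apply: cvg_lim. Qed.

Lemma eq_has_wderive {A f} g {s d} : A s -> (forall t, A t -> f t = g t) ->
  has_wderive A g s d -> has_wderive A f s d.
Proof.
move=> As fg; apply: cvg_trans; apply: near_eq_cvg.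
near=> t; rewrite /diffquot !fg//.
by near: t; exact: near_withinT.
Unshelve. all: by end_near. Qed.

Lemma diffquotK f s t : (t - s) *: diffquot f s t = f t - f s.
Proof.
rewrite /diffquot; have [->|ts] := eqVneq t s; first by rewrite !subrr !scaler0.
by rewrite scalerA divff ?scale1r// subr_eq0.
Qed.

Lemma cvg_within_dnbhs A s : t @[t --> within A s^'] --> s.
Proof. exact: cvg_trans (cvg_within _) (cvg_within _). Qed.

Lemma has_wderive_cvg {A f s d} : has_wderive A f s d ->
  f t @[t --> within A s^'] --> f s.
Proof.
move=> fd.
have -> : f = fun t => (t - s) *: diffquot f s t + f s.
  by apply/funext => t; rewrite diffquotK subrK.
rewrite subrr scale0r add0r -[X in _ --> X](add0r (f s)).
apply: cvgD; last exact: cvg_cst.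
rewrite -(scale0r d) -(subrr s); apply: cvgZ => //.
by apply: cvgB; [exact: cvg_within_dnbhs|exact: cvg_cst].
Qed.

Lemma has_wderiveD {A f g s df dg} :
    has_wderive A f s df -> has_wderive A g s dg ->
  has_wderive A (fun t => f t + g t) s (df + dg).
Proof.
move=> fd gd; rewrite /has_wderive.
have -> : diffquot (fun t => f t + g t) s =
    fun t => diffquot f s t + diffquot g s t.
  by apply/funext => t; rewrite /diffquot -scalerDr opprD addrACA.
exact: cvgD.
Qed.

End RelativeDerivative.

Lemma has_wderiveZ {R : realType} {V : normedModType R} {A : set R}
    {a : R -> R} {f : R -> V} {s da : R} {df : V} :
    has_wderive A a s da -> has_wderive A f s df ->
  has_wderive A (fun t => a t *: f t) s (da *: f s + a s *: df).
Proof.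
move=> ada fdf; rewrite /has_wderive.
have -> : diffquot (fun t => a t *: f t) s =
    fun t => diffquot a s t *: f t + a s *: diffquot f s t.
  apply/funext => t; rewrite /diffquot -[X in _ = X *: _ + _]/(_ * _).
  rewrite -scalerA [a s *: (_ *: _)]scalerA mulrC -scalerA -scalerDr.
  congr (_ *: _).
  by rewrite scalerBl scalerBr addrA subrK.
apply: cvgD; last exact: cvgZl_tmp.
by apply: cvgZ => //; exact: has_wderive_cvg fdf.
Qed.

(** The chain rule, by Caratheodory's argument: the slope [k] of [G] at [f s],
    extended by [dG], is continuous at [0], and the difference quotient of
    [G \o f] is [k (f t - f s)] times that of [f] even where [f t = f s]. *)
Lemma has_wderive_comp {R : realType} {A : set R} {G f : R -> R} {s dG df : R} :
    is_derive (f s) 1 G dG -> has_wderive A f s df ->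
  has_wderive A (G \o f) s (dG * df).
Proof.
move=> [Gd GE] fdf; rewrite /has_wderive.
pose k h := if h == 0 then dG else h^-1 * (G (h + f s) - G (f s)).
have kc : {for 0, continuous k}.
  apply/continuous_withinNx; rewrite {2}/k eqxx -GE.
  apply: cvg_trans Gd; apply: near_eq_cvg; near=> h.
  have h0 : h != 0 by near: h; exact: nbhs_dnbhs_neq.
  by rewrite /k (negPf h0) /= /GRing.scale/= mulr1.
have -> : diffquot (G \o f) s = fun t => k (f t - f s) * diffquot f s t.
  apply/funext => t; rewrite /diffquot /k /= /GRing.scale/= subr_eq0.
  have [->|ts] := eqVneq (f t) (f s); first by rewrite !subrr !mulr0.
  rewrite subrK [RHS]mulrCA; congr (_ * _).
  by rewrite mulrAC mulVf ?mul1r// subr_eq0.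
apply: cvgM => //.
have -> : dG = k 0 by rewrite /k eqxx.
apply: continuous_cvg => //; rewrite -(subrr (f s)).
by apply: cvgB; [exact: has_wderive_cvg fdf|exact: cvg_cst].
Unshelve. all: by end_near. Qed.

(** A point of the segment is a limit of other points of it, from the right
    unless it is the right endpoint, and from the left in that case. *)
Lemma within_itv_proper {R : realType} {L s : R} : 0 < L -> `[0, L]%classic s ->
  ProperFilter (within `[0, L] s^').
Proof.
move=> L0; rewrite /= in_itv/= => /andP[s0 sL].
apply: Build_ProperFilter_ex => P sP.
have {}sP : \forall t \near s, t != s -> `[0, L]%classic t -> P t.
  by exact: sP.
have [sL'|Ls] := ltP s L.
- suff sP' : \forall t \near s^'+, P t.
    by exact: (@filter_ex _ _ (at_right_proper_filter s)).
  near=> t.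
  have st : s < t by near: t; exact: nbhs_right_gt.
  have tL : t <= L by near: t; exact: nbhs_right_le.
  suff : t != s -> `[0, L]%classic t -> P t.
    by apply; [rewrite gt_eqF|rewrite /= in_itv/= tL (le_trans s0)//= ltW].
  by near: t; exact: cvg_within sP.
- suff sP' : \forall t \near s^'-, P t.
    by exact: (@filter_ex _ _ (at_left_proper_filter s)).
  near=> t.
  have ts : t < s by near: t; exact: nbhs_left_lt.
  have t0 : 0 <= t by near: t; apply: nbhs_left_ge; exact: lt_le_trans Ls.
  suff : t != s -> `[0, L]%classic t -> P t.
    by apply; [rewrite lt_eqF|rewrite /= in_itv/= t0 (le_trans _ sL)// ltW].
  by near: t; exact: cvg_within sP.
Unshelve. all: by end_near. Qed.

(** * Vectors of the plane *)

Section PlaneVectors.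
Context {R : realType}.
Implicit Types a b c d k : R.

Lemma vec2Z k a b : k *: vec2 a b = vec2 (k * a) (k * b).
Proof. by apply/matrixP => i j; rewrite !mxE; case: ifP. Qed.

Lemma vec2D a b c d : vec2 a b + vec2 c d = vec2 (a + c) (b + d).
Proof. by apply/matrixP => i j; rewrite !mxE; case: ifP. Qed.

Lemma vec2N a b : - vec2 a b = vec2 (- a) (- b).
Proof. by apply/matrixP => i j; rewrite !mxE; case: ifP. Qed.

Lemma vec2_0 a b : vec2 a b 0 0 = a. Proof. by rewrite !mxE. Qed.
Lemma vec2_1 a b : vec2 a b 1 0 = b. Proof. by rewrite !mxE. Qed.

Lemma vec2_inj a b c d : vec2 a b = vec2 c d -> a = c /\ b = d.
Proof.
move=> e; split; first by rewrite -(vec2_0 a b) e vec2_0.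
by rewrite -(vec2_1 a b) e vec2_1.
Qed.

Lemma mat2_vec2 a b c d x y :
  mat2 a b c d *m vec2 x y = vec2 (a * x + b * y) (c * x + d * y).
Proof.
by apply/matrixP => i j; rewrite !mxE big_ord_recl big_ord1 !mxE/=; case: ifP.
Qed.

Lemma dot_vec2 a b c d : dot (vec2 a b) (vec2 c d) = a * c + b * d.
Proof. by rewrite /dot !mxE big_ord_recl big_ord1 !mxE/=. Qed.

Lemma has_wderive_vec2 {A : set R} {f g : R -> R} {s df dg : R} :
    has_wderive A f s df -> has_wderive A g s dg ->
  has_wderive A (fun t => vec2 (f t) (g t)) s (vec2 df dg).
Proof.
have vec2E a b : vec2 a b = a *: vec2 1 0 + b *: vec2 0 1.
  by rewrite !vec2Z vec2D !mulr1 !mulr0 addr0 add0r.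
move=> fd gd; rewrite /has_wderive [vec2 df dg]vec2E.
have -> : diffquot (fun t => vec2 (f t) (g t)) s =
    fun t => diffquot f s t *: vec2 1 0 + diffquot g s t *: vec2 0 1.
  by apply/funext => t; rewrite -vec2E /diffquot vec2N vec2D vec2Z.
by apply: cvgD; exact: cvgZr_tmp.
Qed.

Lemma has_wderive_coord {A : set R} {X : R -> 'cV[R]_2} (i : 'I_2) {s v} :
  has_wderive A X s v -> has_wderive A (fun t => X t i 0) s (v i 0).
Proof.
move=> Xv; rewrite /has_wderive.
have -> : diffquot (fun t => X t i 0) s =
    (fun M : 'cV[R]_2 => M i 0) \o diffquot X s.
  by apply/funext => t; rewrite /diffquot /= !mxE.
exact: (cvg_comp (diffquot X s) (fun M : 'cV[R]_2 => M i 0) Xv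
  (@coord_continuous R 2 1 i 0 v)).
Qed.

(** The entries are the difference formulas for the angle [2 t - t]. *)
Lemma reflection_tangent (t : R) :
  mat2 (cos (2 * t)) (sin (2 * t)) (sin (2 * t)) (- cos (2 * t))
    *m vec2 (cos t) (sin t) = vec2 (cos t) (sin t).
Proof.
rewrite mat2_vec2; congr vec2.
- by rewrite -cosB; congr cos; ring.
- by rewrite mulNr -sinB; congr sin; ring.
Qed.

(** The reflection fixes the tangent, so its power acts as the identity and the
    stability term, half of identity minus reflection, vanishes there. *)
Lemma surface_energy_tangent (gamma stab : R -> R) q t : q = 0%N \/ q = 1%N ->
  surface_energy_matrix gamma stab q t *m vec2 (cos t) (sin t) =
  gamma t *: vec2 (cos t) (sin t) + derive1 gamma t *: vec2 (- sin t) (cos t).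
Proof.
move=> q01; rewrite /surface_energy_matrix.
set H := (X in X ^+ _); set T := vec2 (cos t) (sin t).
have HT : H *m T = T by exact: reflection_tangent.
have HqT : H ^+ (1 - q) *m T = T.
  by case: q01 => ->; rewrite ?subn0 ?subnn ?expr1 ?expr0// mul1mx.
rewrite mulmxDl -mulmxA HqT -scalemxAl mulmxBl -!scalemxAl mul1mx HT subrr.
rewrite scaler0 addr0 mat2_vec2 !vec2Z vec2D mulrN mulNr.
by congr vec2; rewrite addrC.
Qed.

End PlaneVectors.

(** * The geometric equation *)

Theorem lemma3p1 (R : realType) (gamma stab : R -> R) (q : nat)
    (L : R) (X : R -> 'cV[R]_2) (theta mu : R -> R)
    (q01 : q = 0%N \/ q = 1%N)
    (gamma_gt0 : forall x, 0 < gamma x)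
    (gamma_C2 : C2 gamma)
    (gamma_even : forall x, gamma (- x) = gamma x)
    (gamma_per : periodic gamma (pi *+ 2))
    (stab_per : periodic stab (pi *+ 2))
    (L_gt0 : 0 < L)
    (X_smooth : wsmooth `[0, L] X)
    (theta_smooth : wsmooth `[0, L] theta)
    (r_gt0 : forall s, `[0, L] s -> 0 < rcoord X s)
    (tangentE : forall s, `[0, L] s ->
       tangent L X s = vec2 (cos (theta s)) (sin (theta s))) :
  let r := rcoord X in
  let z := zcoord X in
  let flux s :=
    r s *: (surface_energy_matrix gamma stab q (theta s) *m wderive `[0, L] X s) in
  forall s, `[0, L] s ->
    (mu s = - (gamma (theta s) + derive1n 2 gamma (theta s)) * curvature L X s
            + (gamma (theta s) * wderive `[0, L] z s
               + derive1 gamma (theta s) * wderive `[0, L] r s) / r s)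
    <->
    (wderivable `[0, L] flux s /\
     (r s * mu s) *: normal L X s =
       wderive `[0, L] flux s - gamma (theta s) *: e1 R).
Proof.
move=> r z flux s As.
have pA := within_itv_proper L_gt0 As.
set A := `[0, L]%classic in As pA *.
set c := cos (theta s); set n := sin (theta s).
set g := gamma (theta s); set g' := derive1 gamma (theta s).
set g2 := derive1n 2 gamma (theta s).
have thetaD : has_wderive A theta s (wderive A theta s).
  exact: (theta_smooth 0%N s As).
set dtheta := wderive A theta s in thetaD.
have XD : has_wderive A X s (vec2 c n).
  by rewrite /c /n -(tangentE s As); exact: (X_smooth 0%N s As).
have rD : has_wderive A r s c.
  by have := has_wderive_coord 0 XD; rewrite vec2_0.
have zD : has_wderive A z s n.
  by have := has_wderive_coord 1 XD; rewrite vec2_1.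
have cosD := has_wderive_comp (is_derive_cos _) thetaD.
have sinD := has_wderive_comp (is_derive_sin _) thetaD.
have NsinD : has_wderive A ((fun x => - sin x) \o theta) s (- c * dtheta).
  by apply: has_wderive_comp thetaD; exact: is_deriveN.
have [gammaD gamma'D _] := gamma_C2.
have gD : has_wderive A (gamma \o theta) s (g' * dtheta).
  apply: has_wderive_comp thetaD; rewrite /g' derive1E.
  exact: derivableP.
have g'D : has_wderive A (derive1 gamma \o theta) s (g2 * dtheta).
  apply: has_wderive_comp thetaD; rewrite /g2 derive1nS derive1n1 derive1E.
  exact: derivableP.
have nE : normal L X s = vec2 (- n) c.
  by rewrite /normal tangentE// /perp vec2_0 vec2_1 vec2N opprK.
have kE : curvature L X s = - dtheta.
  have tD : has_wderive A (tangent L X) s (vec2 (- n * dtheta) (c * dtheta)).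
    apply: (eq_has_wderive _ As tangentE).
    exact: has_wderive_vec2 cosD sinD.
  rewrite /curvature nE (has_wderive_val pA tD) dot_vec2.
  have -> : - n * dtheta * - n + c * dtheta * c = dtheta * (c ^+ 2 + n ^+ 2).
    by ring.
  by rewrite cos2Dsin2 mulr1.
pose K := r s * dtheta * (g + g2) + g * n + g' * c.
have fluxD : has_wderive A flux s (K *: vec2 (- n) c + g *: e1 R).
  pose CH t := gamma (theta t) *: vec2 (cos (theta t)) (sin (theta t)) +
    derive1 gamma (theta t) *: vec2 (- sin (theta t)) (cos (theta t)).
  apply: (eq_has_wderive (fun t => r t *: CH t)) => //.
    by move=> t At; rewrite /flux -/(tangent L X t) tangentE//
      surface_energy_tangent.
  have tauD := has_wderiveZ gD (has_wderive_vec2 cosD sinD).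
  have norD := has_wderiveZ g'D (has_wderive_vec2 NsinD cosD).
  have := has_wderiveZ rD (has_wderiveD tauD norD).
  congr has_wderive.
  rewrite /CH /= /e1 !(vec2Z, vec2D) -/c -/n -/g -/g'.
  (* Modulo this relation, both components are polynomial identities. *)
  have cn : n ^+ 2 = 1 - c ^+ 2.
    by rewrite -(cos2Dsin2 (theta s)) addrAC subrr add0r.
  by congr vec2; rewrite /K; ring: cn.
rewrite nE kE (has_wderive_val pA rD) (has_wderive_val pA zD).
rewrite (has_wderive_val pA fluxD) addrK.
have r0 : r s != 0 by rewrite gt_eqF// r_gt0.
have muE : (mu s = - (g + g2) * - dtheta + (g * n + g' * c) / r s) <->
    r s * mu s = K.
  have -> : - (g + g2) * - dtheta + (g * n + g' * c) / r s = K / r s.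
    by rewrite /K; field.
  split=> [->|<-]; first by rewrite mulrC divfK.
  by rewrite mulrC mulKf.
rewrite muE; split=> [->|[_]].
  by split=> //; exact: has_wderive_wderivable fluxD.
rewrite !vec2Z => /vec2_inj[en ec].
(* Dotting both sides with the normal, of square norm 1, leaves the scalars. *)
rewrite -[LHS]mulr1 -[RHS]mulr1 -(cos2Dsin2 (theta s)) -/c -/n.
have -> k : k * (c ^+ 2 + n ^+ 2) = k * c * c - k * (- n) * n by ring.
by rewrite ec en; ring.
Qed.
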